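(* Let $k$ be a field and let $\nu$ be a real-valued monomial valuation on $k(x,y)$ such that $\nu(x)/\nu(y)$ is irrational. Then $$R_\nu=\bigcup_{R_i\in V(P_\nu)} (R_i)_{\mathfrak{m}_i},$$ where $V(P_\nu)$ is the vertex set of $P_\nu$, $\mathfrak{m}_i=\mathfrak{m}_\nu\cap R_i$, and $\mathfrak{m}_\nu$ is the maximal ideal of $R_\nu$.
   Context: $k(x,y)$ is the field of rational functions in two variables over $k$. For $\alpha,\beta\in\mathbb{R}_{\ge 0}$, the (real-valued) monomial valuation $\nu$ on $k(x,y)$ with $\nu(x)=\alpha$, $\nu(y)=\beta$ is defined on nonzero polynomials by $\nu\left(\sum_{i,j}\lambda_{ij}x^iy^j\right)=\min\{i\alpha+j\beta : \lambda_{ij}\neq 0\}$, with $\nu(0)=\infty$, and extended to $k(x,y)$ by $\nu(f/g)=\nu(f)-\nu(g)$. The valuation ring of $\nu$ is $R_\nu=\{f\in k(x,y):\nu(f)\ge 0\}$, a local ring with maximal ideal $\mathfrak m_\nu=\{f\in k(x,y):\nu(f)>0\}$. The valuation tree $T$ is the directed graph whose vertices are certain subrings $k[f,g]$ of $k(x,y)$ (each coming with its displayed pair of generators $f,g$, which are Laurent monomials in $x,y$), defined recursively: $k[x,y]$ is a vertex; and if $k[f,g]$ is a vertex, then $k[f,g/f]$ and $k[g,f/g]$ are vertices, with a directed edge from $k[f,g]$ to each of them. A vertex $k[f,g]$ is $\nu$-positive if $\nu(f)>0$ and $\nu(g)>0$. $P_\nu$ is the subgraph of $T$ whose vertices are the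 $\nu$-positive vertices of $T$. For a prime ideal $\mathfrak m_i$ of a domain $R_i\subset k(x,y)$, $(R_i)_{\mathfrak m_i}$ denotes the localization, viewed as a subring of $k(x,y)$. *)

(* Defs.v *)
From HB Require Import structures.
From mathcomp Require Import all_boot all_order all_algebra.
From mathcomp Require Import fraction generic_quotient.
From mathcomp Require Import classical_sets reals constructive_ereal.
(* Some notations of mpoly clash with those of constructive_ereal. *)
From mathcomp Require Import -(notations) mpoly.

Set Implicit Arguments.
Unset Strict Implicit.
Unset Printing Implicit Defensive.

Import Order.TTheory GRing.Theory Num.Theory.

Local Open Scope classical_set_scope.
Local Open Scope ring_scope.

(* k[x, y] and k(x, y); x is the variable of index ord0, y that of index
   ord_max. *)
Notation poly2 k := (mpoly 2 k).
Notation ratfun2 k := {fraction (mpoly 2 k)}.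

Section RationalFunctions.
Variable k : fieldType.

Definition polyF : poly2 k -> ratfun2 k := @FracField.tofrac (poly2 k).
Definition constF (c : k) : ratfun2 k := polyF (mpolyC 2 c).
Definition varX : ratfun2 k := polyF (mpolyX k (mnm1 ord0)).
Definition varY : ratfun2 k := polyF (mpolyX k (mnm1 ord_max)).

End RationalFunctions.

Arguments varX {k}.
Arguments varY {k}.

Section MonomialValuation.
Variables (k : fieldType) (R : realType) (alpha beta : R).

Definition weight (m : multinom 2) : R :=
  (m ord0)%:R * alpha + (m ord_max)%:R * beta.

Definition polyval (p : poly2 k) : \bar R :=
  \big[mine/+oo%E]_(m <- msupp p) (weight m)%:E.

(* Computed on a representative; monomial_valuationE shows that the value does
   not depend on it. *)
Definition monomial_valuation (f : ratfun2 k) : \bar R :=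
  (polyval (frac (repr f)).1 - polyval (frac (repr f)).2)%E.

End MonomialValuation.

Section ValuationRing.
Variables (k : fieldType) (R : realType) (nu : ratfun2 k -> \bar R).

Definition valuation_ring : set (ratfun2 k) := [set f | (0 <= nu f)%E].

Definition valuation_ideal : set (ratfun2 k) := [set f | (0 < nu f)%E].

End ValuationRing.

Section Localization.
Variable K : fieldType.

(* The localization of the subring A of K at its prime ideal P, inside K. *)
Definition localization (A P : set K) : set K :=
  [set a / s | a in A & s in A `\` P].

End Localization.

Section ValuationTree.
Variable k : fieldType.
Local Notation K := (ratfun2 k).

(* A vertex k[f, g] is encoded by its pair of generators (f, g). *)
Definition adjoin (v : K * K) : set K :=
  [set mmap (@constF k) (fun i : 'I_2 => if i == ord0 then v.1 else v.2) p
     | p in [set: poly2 k]].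

Inductive tree_edge : K * K -> K * K -> Prop :=
| edge_l f g : tree_edge (f, g) (f, g / f)
| edge_r f g : tree_edge (f, g) (g, f / g).

Inductive tree_vertex : K * K -> Prop :=
| vertex_root : tree_vertex (varX, varY)
| vertex_step v w : tree_vertex v -> tree_edge v w -> tree_vertex w.

Definition positive_vertices (R : realType) (nu : K -> \bar R) : set (K * K) :=
  [set v | tree_vertex v /\ (0 < nu v.1)%E /\ (0 < nu v.2)%E].

End ValuationTree.

Section MonomialValuationTheory.
Variables (k : fieldType) (R : realType) (alpha beta : R).
Implicit Types p q : poly2 k.
Local Notation wt := (weight alpha beta).
Local Notation pval := (@polyval k R alpha beta).
Local Notation nu := (@monomial_valuation k R alpha beta).

Lemma weightD m1 m2 : wt (mnm_add m1 m2) = wt m1 + wt m2.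
Proof. by rewrite /weight !mnmDE !natrD !mulrDl addrACA. Qed.

Lemma polyval0 : pval 0 = +oo%E.
Proof.
rewrite /polyval; have -> : msupp (0 : poly2 k) = [::]; last by rewrite big_nil.
by apply/eqP; rewrite msupp_eq0.
Qed.

Lemma polyval_ge p (a : R) :
  reflect {in msupp p, forall m, a <= wt m} (a%:E <= pval p)%E.
Proof.
rewrite /polyval; elim: (msupp p) => [|m s IHs].
  by rewrite big_nil leey; apply: ReflectT.
rewrite big_cons le_min lee_fin.
apply: (iffP andP) => [[le_am /IHs le_as] m'|le_a].
  by rewrite inE => /predU1P[->|/le_as].
split; first by apply: le_a; rewrite mem_head.
by apply/IHs => m' m's; apply: le_a; rewrite inE m's orbT.
Qed.

Lemma polyval_attained p : p != 0 ->
  exists2 m, m \in msupp p & pval p = (wt m)%:E.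
Proof.
rewrite -msupp_eq0 /polyval; elim: (msupp p) => [//|m [|m' s] IHs] _.
  by exists m; rewrite ?mem_head // big_seq1.
have [//|m1 m1s e] := IHs; rewrite big_cons e.
case: (leP (wt m)%:E (wt m1)%:E) => _; first by exists m; rewrite ?mem_head.
by exists m1 => //; rewrite inE m1s orbT.
Qed.

Lemma polyval_le p m : m \in msupp p -> (pval p <= (wt m)%:E)%E.
Proof.
move=> mp; have p0 : p != 0 by rewrite -msupp_eq0; case: (msupp p) mp.
have [m0 m0p e] := polyval_attained p0.
have /polyval_ge/(_ _ mp) : ((wt m0)%:E <= pval p)%E by rewrite e.
by rewrite e lee_fin.
Qed.

(* The initial form of p with respect to the weight a. *)
Let init p (a : R) : poly2 k :=
  \sum_(m <- msupp p | wt m == a) mcoeff m p *: mpolyX k m.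

Let mcoeff_init p a m :
  mcoeff m (init p a) = if wt m == a then mcoeff m p else 0.
Proof.
rewrite /init raddf_sum /=.
have [mp|/memN_msupp_eq0 e] := boolP (m \in msupp p); last first.
  rewrite e if_same big1_seq // => m' /andP[_ m'p].
  rewrite mcoeffZ mcoeffX; case: eqP m'p => [->|_ _]; last by rewrite mulr0.
  by rewrite mcoeff_msupp e eqxx.
rewrite big_mkcond (bigD1_seq m) //= big1 ?addr0.
  by case: ifP => // _; rewrite mcoeffZ mcoeffX eqxx mulr1.
move=> m' /negPf ne; case: ifP => // _.
by rewrite mcoeffZ mcoeffX ne mulr0.
Qed.

Let msupp_mul p q (P Q : pred (multinom 2)) m :
  {in msupp p, forall m1, P m1} -> {in msupp q, forall m2, Q m2} ->
  m \in msupp (p * q) -> exists m1 m2, [/\ P m1, Q m2 & m = mnm_add m1 m2].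
Proof.
move=> hP hQ /msuppM_le/allpairsP[[m1 m2] [/= /hP ? /hQ ? ->]].
by exists m1, m2.
Qed.

Lemma polyvalM p q : pval (p * q) = (pval p + pval q)%E.
Proof.
have [->|p0] := eqVneq p 0.
  rewrite mul0r polyval0; have [->|/polyval_attained[m _ ->]//] := eqVneq q 0.
  by rewrite polyval0.
have [->|q0] := eqVneq q 0.
  by rewrite mulr0 polyval0; have [m _ ->] := polyval_attained p0.
have [mp mpp ep] := polyval_attained p0.
have [mq mqq eqq] := polyval_attained q0.
have lbp m : m \in msupp p -> wt mp <= wt m.
  by move/polyval_le; rewrite ep lee_fin.
have lbq m : m \in msupp q -> wt mq <= wt m.
  by move/polyval_le; rewrite eqq lee_fin.
rewrite ep eqq -EFinD; apply/eqP; rewrite eq_le; apply/andP; split; last first.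
  apply/polyval_ge => m /(msupp_mul lbp lbq)[m1 [m2 [le1 le2 ->]]].
  by rewrite weightD lerD.
set a := wt mp; set b := wt mq.
have initP r c m : m \in msupp (init r c) -> wt m == c.
  by rewrite mcoeff_msupp mcoeff_init; case: ifP; rewrite ?eqxx.
have restP r c (lb : forall m, m \in msupp r -> c <= wt m) m :
    m \in msupp (r - init r c) -> c < wt m.
  rewrite mcoeff_msupp raddfB /= mcoeff_init lt_neqAle [c == _]eq_sym.
  have [_|_] := eqVneq (wt m) c; first by rewrite subrr eqxx.
  by rewrite subr0 -mcoeff_msupp => /lb.
have init_neq0 r c m : m \in msupp r -> wt m = c -> init r c != 0.
  move=> mr <-; apply: contraTneq mr => /(congr1 (mcoeff m)).
  by rewrite mcoeff_init eqxx raddf0 mcoeff_msupp => ->; rewrite eqxx.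
have : init p a * init q b != 0.
  by apply: mulf_neq0; [exact: (init_neq0 p a mp) | exact: (init_neq0 q b mq)].
rewrite -msupp_eq0; case e0 : (msupp _) => [//|m s] _.
have m0 : m \in msupp (init p a * init q b) by rewrite e0 mem_head.
have wm : wt m = a + b.
  have [m1 [m2 [/eqP <- /eqP <- ->]]] := msupp_mul (initP p a) (initP q b) m0.
  by rewrite weightD.
rewrite -wm; apply: polyval_le.
have -> : p * q = init p a * init q b
    + (init p a * (q - init q b) + (p - init p a) * q).
  by rewrite mulrBr mulrBl addrA [X in X + _]addrC subrK [RHS]addrC subrK.
rewrite mcoeff_msupp !raddfD /=.
rewrite [mcoeff m (init p a * (q - _))]memN_msupp_eq0; last first.
  apply/negP => /(msupp_mul (initP p a) (restP q b lbq)).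
  case=> m1 [m2 [/eqP e1 lt2 em]]; move: lt2.
  by rewrite -(ltrD2l (wt m1)) -(weightD m1 m2) -em wm e1 ltxx.
rewrite [mcoeff m ((p - _) * q)]memN_msupp_eq0 ?addr0 -?mcoeff_msupp //.
apply/negP => /(msupp_mul (restP p a lbp) lbq)[m1 [m2 [lt1 le2 em]]].
by have := ltr_leD lt1 le2; rewrite -(weightD m1 m2) -em wm ltxx.
Qed.

Lemma polyval1 : pval 1 = 0%E.
Proof. by rewrite /polyval msupp1 big_seq1 /weight !mnm0E !mul0r addr0. Qed.

Lemma monomial_valuationE p q : q != 0 ->
  nu (polyF p / polyF q) = (pval p - pval q)%E.
Proof.
move=> q0; rewrite /monomial_valuation.
set r := repr _; have d0 : (frac r).2 != 0 := denom_ratioP r.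
have e : (frac r).1 * q = (frac r).2 * p.
  have : (\pi_(ratfun2 k) r)%qT * polyF q = polyF p.
    by rewrite reprK divfK // /polyF tofrac_eq0.
  rewrite /polyF; unlock FracField.tofrac; rewrite -[LHS]FracField.pi_mul.
  move=> /eqmodP; rewrite /= FracField.equivfE /FracField.mulf.
  rewrite !numden_Ratio ?mulf_neq0 ?oner_neq0 // !mulr1.
  by move/eqP.
have := congr1 pval e; rewrite !polyvalM.
have [m _ ->] := polyval_attained q0; have [m' _ ->] := polyval_attained d0.
case: (pval (frac r).1) => [n||]; case: (pval p) => [c||] //= [].
move=> e1; rewrite -EFinB; congr EFin; apply/eqP.
by rewrite subr_eq addrAC eq_sym subr_eq e1 addrC.
Qed.

Lemma monomial_valuation_poly p : nu (polyF p) = pval p.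
Proof.
have := @monomial_valuationE p 1 (oner_neq0 _).
by rewrite /polyF tofrac1 divr1 polyval1 sube0.
Qed.

Lemma monomial_valuation0 : nu 0 = +oo%E.
Proof. by rewrite -tofrac0 monomial_valuation_poly polyval0. Qed.

Let polyvalX m : pval (mpolyX k m) = (wt m)%:E.
Proof. by rewrite /polyval msuppX big_seq1. Qed.

Lemma monomial_valuation_varX : nu varX = alpha%:E.
Proof.
by rewrite monomial_valuation_poly polyvalX /weight !mnm1E /= mul1r mul0r addr0.
Qed.

Lemma monomial_valuation_varY : nu varY = beta%:E.
Proof.
by rewrite monomial_valuation_poly polyvalX /weight !mnm1E /= mul1r mul0r add0r.
Qed.

End MonomialValuationTheory.

(* Main.v *)
(** Let f = p / q with nu f >= 0, and let x^m0 be a monomial of q of minimal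
    value. Dividing p and q by x^m0 leaves finitely many Laurent monomials, all
    of nonnegative value, and a denominator of value 0. So it suffices to find
    a positive vertex k[f, g] containing these Laurent monomials. Moving from
    (f, g) to (f, g / f) when nu f < nu g, and to (g, f / g) when nu g < nu f,
    turns f^i g^j into a monomial with exponents (i + j, j), resp. (i + j, i);
    when the value is nonnegative and i, j have opposite signs this decreases
    |i| + |j|, and nonnegative exponents stay nonnegative. The case
    nu f = nu g never occurs as nu x and nu y are rationally independent. *)
Require Import Defs.
From HB Require Import structures.
From mathcomp Require Import all_boot all_order all_algebra.
From mathcomp Require Import classical_sets reals constructive_ereal.
From mathcomp Require Import -(notations) mpoly.
From mathcomp Require Import fraction generic_quotient zify ring lra.

Set Implicit Arguments.
Unset Strict Implicit.

Import Order.TTheory GRing.Theory Num.Theory.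

Local Open Scope classical_set_scope.
Local Open Scope ring_scope.

(** * Fractions and powers of monomials *)

HB.instance Definition _ (k : fieldType) :=
  GRing.RMorphism.copy (@polyF k) (@FracField.tofrac (poly2 k)).
HB.instance Definition _ (k : fieldType) :=
  GRing.RMorphism.copy (@constF k) (@polyF k \o @mpolyC 2 k).

Lemma ratfunP (k : fieldType) (f : ratfun2 k) :
  exists p q : poly2 k, q != 0 /\ f = polyF p / polyF q.
Proof.
set r := repr f; have d0 : (frac r).2 != 0 := denom_ratioP r.
exists (frac r).1, (frac r).2; split=> //.
apply: (canRL (mulfK _)); first by rewrite /polyF tofrac_eq0.
have {1}-> : f = (\pi_(ratfun2 k) r)%qT by rewrite reprK.
rewrite /polyF; unlock FracField.tofrac; rewrite -[LHS]FracField.pi_mul.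
apply/eqmodP; rewrite /= FracField.equivfE /FracField.mulf.
by rewrite !numden_Ratio ?mulf_neq0 ?oner_neq0 // !mulr1 mulrC.
Qed.

(** Change of generators along an edge of the tree: replacing [y] by [y / x] acts on exponents by a
    shear. *)
Lemma expfz_shear (F : fieldType) (x y : F) (i j : int) : x != 0 ->
  x ^ (i + j) * (y / x) ^ j = x ^ i * y ^ j.
Proof.
move=> x0; rewrite expfzMl exprz_inv expfzDr // -mulrA; congr (_ * _).
by rewrite mulrCA -expfzDr // addrN mulr1.
Qed.

Lemma expfzB_nat (F : fieldType) (x : F) (m n : nat) : x != 0 ->
  x ^ (m%:Z - n%:Z) = x ^+ m / x ^+ n.
Proof. by move=> x0; rewrite expfzDr // -exprnN. Qed.

(** * Closure properties of the subring of a vertex *)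

Section Adjoin.
Variables (k : fieldType) (v : ratfun2 k * ratfun2 k).
Implicit Types f g : ratfun2 k.

Let gen (i : 'I_2) := if i == ord0 then v.1 else v.2.
Let ev : {rmorphism poly2 k -> ratfun2 k} := mmap (@constF k) gen.

Lemma adjoinC c : adjoin v (constF c).
Proof. by exists (mpolyC 2 c) => //; rewrite (mmapC gen (@constF k)). Qed.

Lemma adjoinD f g : adjoin v f -> adjoin v g -> adjoin v (f + g).
Proof.
by move=> [p _ <-] [q _ <-]; exists (p + q); rewrite // (rmorphD ev).
Qed.

Lemma adjoinM f g : adjoin v f -> adjoin v g -> adjoin v (f * g).
Proof.
by move=> [p _ <-] [q _ <-]; exists (p * q); rewrite // (rmorphM ev).
Qed.

Lemma adjoinX f n : adjoin v f -> adjoin v (f ^+ n).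
Proof.
move=> vf; elim: n => [|n IHn]; last by rewrite exprS; apply: adjoinM.
by rewrite expr0 -(rmorph1 (@constF k)); apply: adjoinC.
Qed.

Lemma adjoin_sum (I : eqType) (s : seq I) (F : I -> ratfun2 k) :
  {in s, forall i, adjoin v (F i)} -> adjoin v (\sum_(i <- s) F i).
Proof.
move=> vF; rewrite big_seq; elim/big_ind: _ => //; last exact: adjoinD.
by rewrite -(rmorph0 (@constF k)); apply: adjoinC.
Qed.

Lemma adjoin_fst : adjoin v v.1.
Proof.
by exists (mpolyX k (mnm1 ord0)); rewrite // (mmapX gen (@constF k)) mmap1U.
Qed.

Lemma adjoin_snd : adjoin v v.2.
Proof.
by exists (mpolyX k (mnm1 ord_max)); rewrite // (mmapX gen (@constF k)) mmap1U.
Qed.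

End Adjoin.

Lemma mpolyX_neq0 (n : nat) (k : fieldType) (m : multinom n) :
  mpolyX k m != 0.
Proof. by rewrite -msupp_eq0 msuppX. Qed.

Lemma polyF_mpolyX (k : fieldType) (m : multinom 2) :
  polyF (mpolyX k m) = varX ^+ m ord0 * varY ^+ m ord_max.
Proof.
rewrite mpolyXE_id rmorph_prod big_ord_recl big_ord1 !rmorphXn /=.
by have -> : lift ord0 ord0 = ord_max :> 'I_2 by apply: val_inj.
Qed.

Lemma polyF_sum (k : fieldType) (p : poly2 k) :
  polyF p = \sum_(m <- msupp p) constF (mcoeff m p) * polyF (mpolyX k m).
Proof.
rewrite {1}[p]mpolyE rmorph_sum; apply: eq_bigr => m _ /=.
by rewrite -mul_mpolyC rmorphM.
Qed.

(** * Multiplicativity and nonnegativity of the valuation *)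

Section Valuation.
Variables (k : fieldType) (R : realType) (alpha beta : R).
Implicit Types (f g : ratfun2 k) (p q : poly2 k).
Local Notation pval := (@polyval k R alpha beta).
Local Notation nu := (@monomial_valuation k R alpha beta).

Lemma polyval_fin p : p != 0 -> exists a, pval p = a%:E.
Proof. by move=> /(polyval_attained alpha beta)[m _ ->]; eexists. Qed.

Lemma monomial_valuationM f g : nu (f * g) = (nu f + nu g)%E.
Proof.
have [p [q [q0 ->]]] := ratfunP f; have [p' [q' [q'0 ->]]] := ratfunP g.
rewrite mulf_div -!rmorphM !monomial_valuationE ?mulf_neq0 // !polyvalM.
have [a ->] := polyval_fin q0; have [b ->] := polyval_fin q'0.
case: (pval p) => [c||]; case: (pval p') => [d||] //=.
by rewrite -?EFinB -?EFinD -?EFinB; congr EFin; ring.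
Qed.

Lemma monomial_valuation_div f g a b :
  nu f = a%:E -> nu g = b%:E -> nu (f / g) = (a - b)%:E.
Proof.
move=> fa gb; have g0 : g != 0.
  by apply/eqP => g0; move: gb; rewrite g0 monomial_valuation0.
have := monomial_valuationM (f / g) g; rewrite divfK // fa gb.
by case: (nu _) => //= c [->]; rewrite addrK.
Qed.

(** Over the common denominator [q * q'] both hypotheses bound the monomials of the two numerators
    below by the value of [q * q'], and each monomial of the sum comes from one of them. *)
Lemma monomial_valuation_ge0D f g :
  (0 <= nu f -> 0 <= nu g -> 0 <= nu (f + g)%R)%E.
Proof.
have [p [q [q0 ->]]] := ratfunP f; have [p' [q' [q'0 ->]]] := ratfunP g.
rewrite addf_div ?tofrac_eq0 // -!rmorphM -rmorphD.
rewrite !monomial_valuationE ?mulf_neq0 //.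
have [a ea] := polyval_fin q0; have [b eb] := polyval_fin q'0.
rewrite polyvalM ea eb -EFinD !sube_ge0 ?orbT //.
have le1 u r c d : pval u = c%:E -> (d%:E <= pval r)%E ->
    ((c + d)%:E <= pval (r * u)%R)%E.
  by move=> eu; rewrite polyvalM eu addrC EFinD => /leeD2r; apply.
move=> /(le1 _ _ _ _ eb)/polyval_ge h1 /(le1 _ _ _ _ ea)/polyval_ge h2.
apply/polyval_ge => m /msuppD_le; rewrite mem_cat => /orP[/h1|/h2 //].
by rewrite addrC.
Qed.

Lemma monomial_valuation_constF c : (0 <= nu (constF c))%E.
Proof.
rewrite monomial_valuation_poly; apply/polyval_ge => m.
rewrite msuppC; case: (c == 0) => //=; rewrite inE => /eqP ->.
by rewrite /weight !mnm0E !mul0r addr0.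
Qed.

(** Elements of the subring are built from constants and the two generators by sums and products,
    which preserve nonnegative value. *)
Lemma adjoin_valuation_ge0 (v : ratfun2 k * ratfun2 k) f :
  (0 <= nu v.1)%E -> (0 <= nu v.2)%E -> adjoin v f -> (0 <= nu f)%E.
Proof.
move=> v1 v2 [p _ <-]; rewrite /mmap.
elim/big_ind: _ => [||m _]; first by rewrite monomial_valuation0 leey.
  exact: monomial_valuation_ge0D.
rewrite monomial_valuationM adde_ge0 ?monomial_valuation_constF //.
rewrite /mmap1; elim/big_ind: _ => [|g h g0 h0|i _].
- by rewrite -(rmorph1 (@constF k)) monomial_valuation_constF.
- by rewrite monomial_valuationM adde_ge0.
elim: (m i) => [|n IHn].
  by rewrite expr0 -(rmorph1 (@constF k)) monomial_valuation_constF.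
by rewrite exprS monomial_valuationM adde_ge0 //; case: ifP.
Qed.

(** * Rational independence and the Euclidean algorithm along the tree *)

Definition rationally_independent (a b : R) :=
  forall i j : int, i%:~R * a + j%:~R * b = 0 -> i = 0 /\ j = 0.

Lemma rationally_independentC a b :
  rationally_independent a b -> rationally_independent b a.
Proof. by move=> ab i j; rewrite addrC => /ab[-> ->]. Qed.

(** Keeps independence along an edge: a relation (i, j) for the new values is the relation (i - j,
    j) for the old ones. *)
Lemma rationally_independentB a b :
  rationally_independent a b -> rationally_independent a (b - a).
Proof.
move=> ab i j ij; have [] := ab (i - j) j; last first.
  by move=> + j0; rewrite j0 subr0.
by rewrite -[RHS]ij rmorphB /=; ring.
Qed.

Lemma irrational_independent : irrational (alpha / beta) ->
  rationally_independent alpha beta.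
Proof.
move=> irr i j ij; have b0 : beta != 0.
  apply/eqP => b0; apply: irr; exists 0 => //.
  by rewrite b0 invr0 mulr0 rmorph0.
have [i0|i0] := eqVneq i 0.
  split=> //; move/eqP: ij; rewrite i0 mul0r add0r mulf_eq0 (negPf b0) orbF.
  by rewrite intr_eq0 => /eqP.
case: irr; exists (- j%:~R / i%:~R) => //.
rewrite fmorph_div rmorphN /= !ratr_int.
have i0' : i%:~R != 0 :> R by rewrite intr_eq0.
have -> : - j%:~R = i%:~R * alpha / beta.
  by apply: (canRL (mulfK b0)); apply/eqP; rewrite mulNr eq_sym -addr_eq0 ij.
by rewrite [LHS]mulrAC [i%:~R * _]mulrC mulfK.
Qed.

(* Termination measure of the Euclidean algorithm on exponents. *)
Definition negativity (e : int * int) : nat :=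
  if (0 <= e.1) && (0 <= e.2) then 0%N else (`|e.1| + `|e.2|)%N.

Lemma negativityC i j : negativity (i, j) = negativity (j, i).
Proof. by rewrite /negativity /= andbC addnC. Qed.

(** Since i a + j b = (i + j) a + j (b - a) is nonnegative, i < 0 forces j > 0, and j < 0 forces i +
    j > 0. In the first case either i + j >= 0 and the measure drops to 0, or |i + j| < |i|; in the
    second 0 < i + j < i. *)
Lemma negativity_step (a b : R) (i j : int) n : 0 < a -> a < b ->
  0 <= i%:~R * a + j%:~R * b -> (negativity (i, j) <= n.+1)%N ->
  (negativity (i + j, j)%R <= n)%N.
Proof.
move=> a0 ab ij.
have hi : i < 0 -> 0 < j.
  move=> i0; rewrite ltNge; apply/negP => j0.
  have i0' : (i%:~R : R) < 0 by rewrite ltrz0.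
  have j0' : (j%:~R : R) <= 0 by rewrite lerz0.
  nra.
have hj : j < 0 -> 0 < i + j.
  move=> j0; rewrite ltNge; apply/negP => i0.
  have j0' : (j%:~R : R) < 0 by rewrite ltrz0.
  have i0' : (i%:~R + j%:~R : R) <= 0 by rewrite -intrD lerz0.
  nra.
clear ij; rewrite /negativity /=; case: ifP; case: ifP => /=; lia.
Qed.

(** The edge taken depends only on [a] and [b], so all exponents in [s] follow the same path and end
    in one vertex; [n] bounds their measures uniformly and drives the induction. *)
Lemma monomials_in_positive_vertex n (f g : ratfun2 k) (a b : R)
    (s : seq (int * int)) :
  tree_vertex (f, g) -> nu f = a%:E -> nu g = b%:E -> 0 < a -> 0 < b ->
  rationally_independent a b ->
  {in s, forall e, 0 <= e.1%:~R * a + e.2%:~R * b} ->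
  {in s, forall e, negativity e <= n}%N ->
  exists2 w, positive_vertices nu w &
    {in s, forall e, adjoin w (f ^ e.1 * g ^ e.2)}.
Proof.
elim: n f g a b s => [|n IHn] f g a b s vfg nf ng a0 b0 ab s_ge0 sn.
  exists (f, g); first by split=> //=; rewrite nf ng !lte_fin.
  (* Measure 0 means that both exponents are nonnegative, so the current vertex already works. *)
  move=> [i j] /sn; rewrite /negativity /= => ijn.
  have [] : 0 <= i /\ 0 <= j by case: ifP ijn; lia.
  case: i j {ijn} => // i [] // j _ _; apply: adjoinM; apply: adjoinX.
    exact: (adjoin_fst (f, g)).
  exact: (adjoin_snd (f, g)).
have f0 : f != 0.
  by apply/eqP => f0; move: nf; rewrite f0 monomial_valuation0.
have g0 : g != 0.
  by apply/eqP => g0; move: ng; rewrite g0 monomial_valuation0.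
have [ltab|ltba|eqab] := ltgtP a b.
- have [||||||||w wP ws] := IHn f (g / f) a (b - a)
      [seq (e.1 + e.2, e.2) | e <- s].
  + by apply: vertex_step vfg _; constructor.
  + by [].
  + exact: monomial_valuation_div.
  + by [].
  + by rewrite subr_gt0.
  + exact: rationally_independentB.
  + move=> _ /mapP[e /s_ge0 es ->] /=.
    by move: es; congr (_ <= _); rewrite rmorphD /=; ring.
  + move=> _ /mapP[[i j] es ->] /=.
    apply: (negativity_step (a := a) (b := b)) => //.
      exact: (s_ge0 _ es).
    exact: sn.
  exists w; first exact: wP.
  move=> [i j] ijs; rewrite -(expfz_shear g i j f0).
  exact: (ws _ (map_f (fun e => (e.1 + e.2, e.2)) ijs)).
- have [||||||||w wP ws] := IHn g (f / g) b (a - b)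
      [seq (e.2 + e.1, e.1) | e <- s].
  + by apply: vertex_step vfg _; constructor.
  + by [].
  + exact: monomial_valuation_div.
  + by [].
  + by rewrite subr_gt0.
  + exact/rationally_independentB/rationally_independentC.
  + move=> _ /mapP[e /s_ge0 es ->] /=.
    by move: es; congr (_ <= _); rewrite rmorphD /=; ring.
  + move=> _ /mapP[[i j] es ->] /=.
    apply: (negativity_step (a := b) (b := a)) => //.
      by rewrite addrC; exact: (s_ge0 _ es).
    by rewrite negativityC; exact: sn.
  exists w; first exact: wP.
  move=> [i j] ijs; rewrite mulrC -(expfz_shear f j i g0).
  exact: (ws _ (map_f (fun e => (e.2 + e.1, e.1)) ijs)).
- by have [] := ab 1 (- 1); rewrite // eqab rmorphN rmorph1 mulN1r mul1r subrr.
Qed.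

End Valuation.

(** * The two inclusions *)

Unset Implicit Arguments.
Set Strict Implicit.

Theorem theorem3p15 (k : fieldType) (R : realType) (alpha beta : R)
    (alpha_ge0 : 0 <= alpha) (beta_ge0 : 0 <= beta)
    (alpha_beta_irrational : irrational (alpha / beta)) :
  let nu := @monomial_valuation k R alpha beta in
  let m_nu := valuation_ideal nu in
  valuation_ring nu =
    \bigcup_(v in positive_vertices nu)
      localization (adjoin v) (m_nu `&` adjoin v).
Proof.
move=> nu m_nu; apply/seteqP; split=> f.
  have ab := irrational_independent alpha_beta_irrational.
  have a0 : 0 < alpha.
    rewrite lt_neqAle alpha_ge0 andbT eq_sym; apply/eqP => a0.
    by have [] := ab 1 0; rewrite // a0 mulr0 mul0r addr0.
  have b0 : 0 < beta.
    rewrite lt_neqAle beta_ge0 andbT eq_sym; apply/eqP => b0.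
    by have [] := ab 0 1; rewrite // b0 mulr0 mul0r addr0.
  have [p [q [q0 ->]]] := ratfunP f; rewrite /valuation_ring /=.
  have [m0 m0q eq0] := polyval_attained alpha beta q0.
  rewrite /nu monomial_valuationE // eq0 sube_ge0 ?orbT // => /polyval_ge m0p.
  have m0q' :
      {in msupp q, forall m, weight alpha beta m0 <= weight alpha beta m}.
    by apply/polyval_ge; rewrite eq0.
  (* Exponents of the Laurent monomial x^m / x^m0. The list [s] covers numerator and denominator
     together, so that a single vertex contains both. *)
  pose e (m : multinom 2) : int * int :=
    ((m ord0)%:Z - (m0 ord0)%:Z, (m ord_max)%:Z - (m0 ord_max)%:Z).
  pose s := [seq e m | m <- msupp p ++ msupp q].
  have [||w wP ws] := @monomials_in_positive_vertex k R alpha beta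
      (\max_(i <- s) negativity i) varX varY alpha beta s (vertex_root k)
      (monomial_valuation_varX _ _ _) (monomial_valuation_varY _ _ _) a0 b0 ab.
  - move=> _ /mapP[m mpq ->].
    have : weight alpha beta m0 <= weight alpha beta m.
      by move: mpq; rewrite mem_cat => /orP[/m0p|/m0q'].
    by rewrite -subr_ge0 /weight !rmorphB /=; congr (_ <= _); ring.
  - by move=> i si; apply: leq_bigmax_seq.
  have X0 : varX != 0 :> ratfun2 k by rewrite tofrac_eq0 mpolyX_neq0.
  have Y0 : varY != 0 :> ratfun2 k by rewrite tofrac_eq0 mpolyX_neq0.
  pose M : ratfun2 k := polyF (mpolyX k m0).
  have M0 : M != 0 by rewrite tofrac_eq0 mpolyX_neq0.
  have wM r : {subset msupp r <= msupp p ++ msupp q} -> adjoin w (polyF r / M).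
    move=> rpq; rewrite polyF_sum mulr_suml; apply: adjoin_sum => m mr.
    rewrite -mulrA; apply: adjoinM; first exact: adjoinC.
    rewrite /M !polyF_mpolyX invfM mulrACA.
    rewrite -(expfzB_nat _ _ X0) -(expfzB_nat _ _ Y0).
    exact: (ws _ (map_f e (rpq _ mr))).
  exists w => //; exists (polyF p / M).
    by apply: wM => m mp; rewrite mem_cat mp.
  exists (polyF q / M); last by rewrite invf_div mulrA divfK.
  split; first by apply: wM => m mq; rewrite mem_cat mq orbT.
  (* By minimality of [m0], [q] and [M] have the same value, so [polyF q / M] has value 0 and avoids
     the maximal ideal. *)
  case; rewrite /m_nu /valuation_ideal /=.
  rewrite /nu monomial_valuationE ?mpolyX_neq0 // eq0.
  by rewrite /polyval msuppX big_seq1 subee // ltxx.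
move=> [v [_ [v1 v2]] [a va [s [vs sP] <-]]].
have A_ge0 g : adjoin v g -> (0 <= nu g)%E.
  by apply: adjoin_valuation_ge0; apply: ltW.
(* The denominator lies in the subring, hence has nonnegative value, and outside the ideal, hence
   has no positive value; dividing by it leaves the value of [a] unchanged. *)
have s0 : nu s = 0%E.
  apply/eqP; rewrite eq_le A_ge0 // andbT leNgt.
  by apply/negP => s_gt0; apply: sP.
have s_neq0 : s != 0.
  by apply/eqP => e; move: s0; rewrite e /nu monomial_valuation0.
have := A_ge0 a va; rewrite -{1}(divfK s_neq0 a) /nu monomial_valuationM -/nu.
by rewrite s0 adde0.
Qed.
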